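(* Let $(X,f)$ be a dynamical system and $x\in X$. Then $$\underline{h}_{\mathrm{cor}}(f,x)\le\overline{h}_{\mathrm{cor}}(f,x)\le h_{\mathrm{top}}\left(f|_{\overline{\mathrm{Orb}}_f(x)}\right)\le h_{\mathrm{top}}(f).$$
   Context: A dynamical system is a pair $(X,f)$ where $X=(X,\varrho)$ is a compact metric space and $f:X\to X$ is continuous. $\overline{\mathrm{Orb}}_f(x)$ is the closure of the forward orbit $\{f^n(x):n\ge0\}$, and $h_{\mathrm{top}}$ denotes topological entropy (with natural logarithms). $\mathbb{N}=\{1,2,\dots\}$. For $m\in\mathbb{N}$ let $\varrho^f_m(y,z)=\max_{0\le i<m}\varrho(f^i(y),f^i(z))$. For $x\in X$, $m,n\in\mathbb{N}$, $\varepsilon>0$, $$C^f_m(x,n,\varepsilon)=\frac1{n^2}\,\mathrm{card}\{(i,j):0\le i,j<n,\ \varrho^f_m(f^i(x),f^j(x))\le\varepsilon\},$$ $\overline{c}^f_m(x,\varepsilon)=\limsup_{n\to\infty}C^f_m(x,n,\varepsilon)$, $\underline{c}^f_m(x,\varepsilon)=\liminf_{n\to\infty}C^f_m(x,n,\varepsilon)$. The upper and lower local correlation entropies of $f$ at $x$ are $$\overline{h}_{\mathrm{cor}}(f,x)=\lim_{\varepsilon\to0}\limsup_{m\to\infty}\left(-\frac1m\right)\log\underline{c}^f_m(x,\varepsilon),\qquad \underline{h}_{\mathrm{cor}}(f,x)=\lim_{\varepsilon\to0}\liminf_{m\to\infty}\left(-\frac1m\right)\log\overline{c}^f_m(x,\varepsilon).$$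 *)

(* Defs.v *)
From HB Require Import structures.
From mathcomp Require Import all_boot all_order all_algebra finmap.
From mathcomp Require Import all_classical all_reals all_analysis.

Set Implicit Arguments.
Unset Strict Implicit.
Unset Printing Implicit Defensive.

Import Order.TTheory GRing.Theory Num.Theory.
Import numFieldNormedType.Exports.

Local Open Scope classical_set_scope.
Local Open Scope ring_scope.

(* The library equips [set_type A] with the subspace pseudometric; the distance
   of the ambient space, restricted to [A], makes it a metric space. *)
Section SubspaceMetric.
Context {R : realType} (X : metricType R) (A : set X).

Definition sub_mdist (y z : A) : R := mdist (set_val y) (set_val z).

Let sub_mdist_ge0 y z : 0 <= sub_mdist y z.
Proof. exact: mdist_ge0. Qed.

Let sub_mdist_positivity y z : sub_mdist y z = 0 -> y = z.
Proof. by move=> /mdist_positivity; exact: val_inj. Qed.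

Let sub_ballEmdist (y : A) (d : R) : ball y d = [set z | sub_mdist y z < d].
Proof. by rewrite -initial_ballE ballEmdist. Qed.

HB.instance Definition _ := PseudoMetric_isMetric.Build R (set_type A)
  sub_mdist_ge0 sub_mdist_positivity sub_ballEmdist.

End SubspaceMetric.

Section Restriction.
Context {X : Type} (A : set X) (f : X -> X).

Definition restr (fA : forall y, A y -> A (f y)) (y : A) : A :=
  SigSub (mem_set (fA _ (set_valP y))).

End Restriction.

Section OrbitClosure.
Context {X : topologicalType}.

Definition orbit_closure (f : X -> X) (x : X) : set X :=
  closure (range (fun n => iter n f x)).

Lemma orbit_closure_stable (f : X -> X) (x : X) : continuous f ->
  forall y, orbit_closure f x y -> orbit_closure f x (f y).
Proof.
move=> cf y Oy B /cf /Oy [_ [[n _ <-] Bn]].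
by exists (iter n.+1 f x); split=> //; exists n.+1.
Qed.

End OrbitClosure.

Section Entropies.
Context {R : realType} {X : metricType R}.
Implicit Types (f : X -> X) (x y z : X) (m n : nat) (e : R).

Definition bowen_dist f m y z : R :=
  \big[Num.max/0]_(i < m) mdist (iter i f y) (iter i f z).

Definition corr_sum f m x n e : R :=
  (n%:R ^+ 2)^-1 *
  #|[pred p : 'I_n * 'I_n |
      bowen_dist f m (iter p.1 f x) (iter p.2 f x) <= e]|%:R.

Definition upper_corr f m x e : \bar R :=
  limn_esup (fun n => (corr_sum f m x n e)%:E).

Definition lower_corr f m x e : \bar R :=
  limn_einf (fun n => (corr_sum f m x n e)%:E).

(* The junk terms of index 0 (where 0^-1 = 0) in these sequences and those
   below do not affect the upper and lower limits. *)
Definition upper_hcor f x : \bar R :=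
  lim ((fun e => limn_esup (fun m =>
    (- m%:R^-1)%:E * lne (lower_corr f m x e))%E) @ 0^'+).

Definition lower_hcor f x : \bar R :=
  lim ((fun e => limn_einf (fun m =>
    (- m%:R^-1)%:E * lne (upper_corr f m x e))%E) @ 0^'+).

(* Topological entropy by Bowen's definition: exponential growth rate of the
   maximal cardinality of (n, e)-separated sets. *)
Definition separated f n e (E : {fset X}) : Prop :=
  forall y z, y \in E -> z \in E -> y != z -> e < bowen_dist f n y z.

Definition max_separated f n e : \bar R :=
  ereal_sup [set (#|` E|%:R)%:E | E in [set E | separated f n e E]].

Definition htop f : \bar R :=
  lim ((fun e => limn_esup (fun n =>
    (n%:R^-1)%:E * lne (max_separated f n e))%E) @ 0^'+).

End Entropies.

(* Main.v *)
(* Join two times i, j < n when the Bowen distance d_m between f^i(x) and f^j(x)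
   is at most e. An independent set of this graph gives an (m, e)-separated set
   of orbit points, so its size is at most the maximal size s(m, e) of such a
   set, and Turan's theorem gives at least n^2 / s(m, e) adjacent pairs (loops
   included). Hence C_m(x, n, e) >= 1 / s(m, e), at the same scale e. *)

Require Import Defs.
From mathcomp Require Import all_boot all_order all_algebra finmap.
From mathcomp Require Import all_classical all_reals all_analysis.
From mathcomp Require Import ring.

Set Implicit Arguments.
Unset Strict Implicit.
Unset Printing Implicit Defensive.

Import Order.TTheory GRing.Theory Num.Theory.
Import numFieldNormedType.Exports.

Local Open Scope classical_set_scope.
Local Open Scope ring_scope.

(** * Turan's theorem for a reflexive symmetric relation *)

Section Turan.
Variables (F : realFieldType) (T : finType) (r : rel T).
Hypotheses (r_refl : reflexive r) (r_sym : symmetric r).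

(* Greedy choice: the closed neighbourhood of a vertex of least degree
   contributes at most 1 to the sum. *)
Lemma caro_wei (S : {set T}) : exists A : {set T},
  [/\ A \subset S, {in A &, forall x y, x != y -> ~~ r x y} &
      \sum_(x in S) (#|[pred y | r x y]|%:R)^-1 <= #|A|%:R :> F].
Proof.
have [n] := ubnP #|S|; elim: n S => // n IHn S /ltnSE leSn.
have [->|[v0 v0S]] := set_0Vmem S.
  by exists finset.set0; split; rewrite ?big_set0 ?cards0// => x y; rewrite inE.
(* [v] is chosen in [S], but degrees are counted in all of [T], so the summands stay the same when
   the induction passes to [S :\: N]. *)
have [v /= vS vmin] :=
  @arg_minnP _ v0 [in S] (fun x => #|[pred y | r x y]|) v0S.
pose N := [set y | r v y]%SET.
have d_gt0 x : (0 < #|[pred y | r x y]|)%N.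
  by apply/card_gt0P; exists x; rewrite inE.
have [|A [AS Aind Asum]] := IHn (S :\: N)%SET.
  apply: leq_trans leSn; apply: proper_card; apply/properP; split.
    exact: subsetDl.
  by exists v; rewrite // !inE r_refl.
exists (v |: A)%SET.
have AN x : x \in A -> ~~ r v x.
  by move=> /(fintype.subsetP AS); rewrite !inE => /andP[].
split.
- rewrite finset.subUset finset.sub1set vS.
  by apply: fintype.subset_trans AS _; exact: subsetDl.
- move=> x y /setU1P[->|xA] /setU1P[->|yA]; rewrite ?eqxx//.
  + by move=> _; exact: AN.
  + by move=> _; rewrite r_sym; exact: AN.
  + exact: Aind.
- rewrite cardsU1 (contraL (@AN v)) ?negbK ?r_refl// natrD.
  rewrite (big_setID N)/=; apply: lerD => //.
  apply: (@le_trans _ _ (\sum_(x in S :&: N) (#|[pred y | r v y]|%:R)^-1)).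
    apply: ler_sum => x; rewrite inE => /andP[xS _].
    by rewrite lef_pV2 ?posrE ?ltr0n// ler_nat vmin.
  rewrite sumr_const -[leLHS]mulr_natl ler_pdivrMr ?ltr0n// mul1r ler_nat.
  rewrite (@eq_card _ [pred y | r v y] (mem N)); last by move=> y; rewrite !inE.
  by apply: subset_leq_card; exact: subsetIr.
Qed.

(** Summing the degrees counts the adjacent ordered pairs, so Cauchy-Schwarz bounds the sum of
    [caro_wei] over all of [T] from below by the square of [#|T|] over that count. *)
Lemma turan : exists A : {set T},
  {in A &, forall x y, x != y -> ~~ r x y} /\
  #|T|%:R ^+ 2 <= #|A|%:R * #|[pred p : T * T | r p.1 p.2]|%:R :> F.
Proof.
have [A [_ Aind Asum]] := caro_wei finset.setT; exists A; split=> //.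
pose d x : F := #|[pred y | r x y]|%:R.
have d_gt0 x : 0 < d x.
  by rewrite ltr0n; apply/card_gt0P; exists x; rewrite inE.
set P : F := #|[pred p | r p.1 p.2]|%:R.
have PE : P = \sum_x d x.
  rewrite /P -sum1_card -(pair_big_dep predT r (fun _ _ => 1%N))/= natr_sum.
  by apply: eq_bigr => x _; rewrite sum1_card.
have [T0|T_gt0] := posnP #|T|; first by rewrite T0 expr0n/= mulr_ge0 ?ler0n.
have P_gt0 : 0 < P.
  move/card_gt0P: T_gt0 => [x _]; rewrite PE (bigD1 x)//=.
  by rewrite ltr_pwDl// sumr_ge0// => y _; exact: ltW.
(* Cauchy-Schwarz, through the tangent line of [t |-> 1/t] at [1/c] *)
have tangent (c t : F) : 0 < t -> c *+ 2 - c ^+ 2 * t <= t^-1.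
  move=> t0; rewrite -subr_ge0.
  have -> : t^-1 - (c *+ 2 - c ^+ 2 * t) = (c * t - 1) ^+ 2 / t.
    by field; rewrite gt_eqF.
  by rewrite divr_ge0 ?sqr_ge0 ?ltW.
(* [c] is the inverse of the mean degree; with it the tangent bounds add up to exactly
   [#|T|%:R ^+ 2 / P]. *)
pose c := #|T|%:R / P.
have : \sum_x (c *+ 2 - c ^+ 2 * d x) <= #|A|%:R.
  apply: le_trans Asum; under [leRHS]eq_bigl do rewrite inE.
  by apply: ler_sum => x _; exact: tangent.
rewrite sumrB -mulr_sumr -PE sumr_const => le_A.
rewrite -ler_pdivrMr//; apply: le_trans le_A.
rewrite -[_ *+ #|_|]mulr_natr /c le_eqVlt; apply/orP; left; apply/eqP.
by move: (#|T|%:R) (P) P_gt0 => t p p_gt0; field; rewrite gt_eqF.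
Qed.

End Turan.

(** * Monotonicity of upper and lower limits, and limits as the scale tends to 0 *)

Section Limits.
Context {R : realType}.

(** The upper limit is an infimum of suprema over eventual sets [V]; each [V] may be shrunk to the
    indices where [u n <= v n]. *)
Lemma le_limn_esup (u v : (\bar R)^nat) :
  (\forall n \near \oo, (u n <= v n)%E) -> (limn_esup u <= limn_esup v)%E.
Proof.
move=> uv; apply: le_ereal_inf_tmp => _ /= [V FV <-].
apply: (@le_trans _ _ (ereal_sup (u @` (V `&` [set n | (u n <= v n)%E])))).
  apply: ereal_inf_lbound; exists (V `&` [set n | (u n <= v n)%E]) => //.
  exact: filterI.
apply: ge_ereal_sup => _ /= [n [Vn uvn] <-]; apply: le_trans uvn _.
by apply: ereal_sup_ubound; exists n.
Qed.

Lemma le_limn_einf (u v : (\bar R)^nat) :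
  (\forall n \near \oo, (u n <= v n)%E) -> (limn_einf u <= limn_einf v)%E.
Proof.
move=> uv; rewrite /limn_einf leeN2; apply: le_limn_esup.
by apply: filterS uv => n; rewrite leeN2.
Qed.

Lemma limn_einf_cst (a : \bar R) : limn_einf (fun=> a) = a.
Proof. by have [->] := cvg_limn_einf_sup (@cvg_cst _ a nat \oo _). Qed.

(** Monotonicity extends to the whole extended line because [lne] is [-oo] on nonpositive
    arguments. *)
Lemma le_lne : {homo @lne R : x y / (x <= y)%E}.
Proof.
move=> x y xy; have [x_le0|x_gt0] := leP x 0%E; first by rewrite le0_lneNy ?leNye.
by rewrite lee_lne// in_itv/= leey andbT ltW// (lt_le_trans x_gt0).
Qed.

(** The entropies are written with [lim], whose values can be compared once convergence is known;
    monotonicity in the scale provides it. *)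
Lemma cvg_at_right_nonincreasing (f : R -> \bar R) :
  (forall e d, 0 < e -> e <= d -> (f d <= f e)%E) -> cvg (f @ 0^'+).
Proof.
move=> f_noninc.
have : {in `]0%R, +oo[ &, nondecreasing_fun (fun e => - f e)%E}.
  by move=> e d; rewrite !in_itv/= !andbT => e0 _ ed; rewrite leeN2 f_noninc.
move=> /(@nondecreasing_at_right_cvge R _ 0 +oo%O isT)/cvgeN.
under eq_cvg do rewrite oppeK.
exact: cvgP.
Qed.

Lemma le_lim_at_right (f g : R -> \bar R) :
  (forall e d, 0 < e -> e <= d -> (f d <= f e)%E) ->
  (forall e d, 0 < e -> e <= d -> (g d <= g e)%E) ->
  (forall e, 0 < e -> (f e <= g e)%E) ->
  (lim (f @ 0^'+) <= lim (g @ 0^'+))%E.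
Proof.
move=> /cvg_at_right_nonincreasing cf /cvg_at_right_nonincreasing cg fg.
by apply: lee_lim => //; near=> e; apply: fg; near: e; exact: nbhs_right_gt.
Unshelve. all: by end_near. Qed.

End Limits.

(** * Correlation entropies against topological entropy *)

Section Entropies.
Context {R : realType} {X : metricType R}.
Implicit Types (f : X -> X) (x y z : X) (m n : nat) (e d : R).

Lemma bowen_distxx f m y : bowen_dist f m y y = 0.
Proof.
rewrite /bowen_dist; elim/big_ind: _ => // [_ _ -> ->|i _]; last exact: mdistxx.
by rewrite maxxx.
Qed.

Lemma bowen_distC f m y z : bowen_dist f m y z = bowen_dist f m z y.
Proof. by apply: eq_bigr => i _; rewrite metric_sym. Qed.

Lemma corr_sum_ge0 f m x n e : 0 <= corr_sum f m x n e.
Proof. by rewrite mulr_ge0 ?invr_ge0 ?exprn_ge0 ?ler0n. Qed.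

Lemma le_corr_sum f m x n e d : e <= d -> corr_sum f m x n e <= corr_sum f m x n d.
Proof.
move=> ed; rewrite ler_wpM2l ?invr_ge0 ?exprn_ge0 ?ler0n// ler_nat.
apply: subset_leq_card; apply/fintype.subsetP => p; rewrite !inE => /le_trans; exact.
Qed.

Lemma le_lower_corr f m x e d : e <= d ->
  (lower_corr f m x e <= lower_corr f m x d)%E.
Proof.
by move=> ed; apply: le_limn_einf; apply: nearW => n; rewrite lee_fin le_corr_sum.
Qed.

Lemma le_upper_corr f m x e d : e <= d ->
  (upper_corr f m x e <= upper_corr f m x d)%E.
Proof.
by move=> ed; apply: le_limn_esup; apply: nearW => n; rewrite lee_fin le_corr_sum.
Qed.

Lemma le_max_separated f m e d : e <= d ->
  (max_separated f m d <= max_separated f m e)%E.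
Proof.
move=> ed; apply: ereal_sup_le => _ /= [E sepE <-]; exists E => //.
by move=> y z yE zE yz; apply: le_lt_trans ed (sepE _ _ yE zE yz).
Qed.

Lemma max_separated_ge1 f m e x : (1 <= max_separated f m e)%E.
Proof.
apply: ereal_sup_ubound; exists [fset x]%fset; last by rewrite cardfs1.
by move=> y z; rewrite !inE => /eqP -> /eqP ->; rewrite eqxx.
Qed.

(** Turan's bound on the graph of times. The product form also covers an infinite [max_separated];
    at [n = 0] the correlation sum is 0. *)
Lemma corr_sum_max_separated f m x n e : 0 <= e -> (0 < n)%N ->
  (1 <= max_separated f m e * (corr_sum f m x n e)%:E)%E.
Proof.
move=> e0 n_gt0.
pose r : rel 'I_n := fun i j => bowen_dist f m (iter i f x) (iter j f x) <= e.
have r_refl : reflexive r by move=> i; rewrite /r bowen_distxx.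
have r_sym : symmetric r by move=> i j; rewrite /r bowen_distC.
have [A [Aind turanA]] := @turan R _ r r_refl r_sym.
(* Two times at the same point are at Bowen distance 0, hence adjacent, so independent times give
   distinct points. *)
have inj : {in A &, injective (fun i : 'I_n => iter i f x)}.
  move=> i j iA jA ij; apply/eqP/negP => /negP /(Aind _ _ iA jA).
  by rewrite /r ij bowen_distxx e0.
pose E := [fset iter (i : 'I_n) f x | i in A]%fset.
have cardE : #|` E| = #|A| by rewrite card_in_imfset//= -cardE.
(* Adjacency is [<= e] and separation is [e <], so non-adjacent means separated at the same
   scale. *)
have sepE : Defs.separated f m e E.
  move=> _ _ /imfsetP[i iA ->] /imfsetP[j jA ->] ij.
  by rewrite ltNge; apply: Aind => //; apply: contraNneq ij => ->.
apply: (@le_trans _ _ (#|A|%:R%:E * (corr_sum f m x n e)%:E)%E).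
  rewrite -EFinM lee_fin /corr_sum mulrCA mulrC ler_pdivlMr ?mul1r; last first.
    by rewrite exprn_gt0// ltr0n.
  by move: turanA; rewrite card_ord.
apply: lee_wpmul2r; first by rewrite lee_fin corr_sum_ge0.
by rewrite -cardE; apply: ereal_sup_ubound; exists E.
Qed.

(** If the maximum is a finite [M], then [M >= 1] and every correlation sum with [n > 0] is at least
    [M^-1], hence so is the lower limit. *)
Lemma lne_lower_corr f m x e : 0 <= e ->
  (- lne (lower_corr f m x e) <= lne (max_separated f m e))%E.
Proof.
move=> e0; have M1 := max_separated_ge1 f m e x.
have MC n := @corr_sum_max_separated f m x n e e0.
case: (max_separated f m e) M1 MC => [M| |]//; last by move=> _ _; rewrite leey.
rewrite lee_fin => M1 MC; have M0 := lt_le_trans ltr01 M1.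
rewrite leeNl -lneV//; apply: le_lne; rewrite -(limn_einf_cst (M^-1%:E)).
apply: le_limn_einf; near=> n.
rewrite lee_fin -div1r ler_pdivrMr// mulrC -lee_fin EFinM MC//.
by near: n; exact: nbhs_infty_gt.
Unshelve. all: by end_near. Qed.

Lemma mul_oppr_inve (m : nat) (a : \bar R) :
  ((- m%:R^-1)%:E * a = (m%:R^-1)%:E * - a)%E.
Proof. by rewrite EFinN muleN mulNe. Qed.

Lemma inv_nat_ge0 m : (0 <= (m%:R^-1)%:E :> \bar R)%E.
Proof. by rewrite lee_fin invr_ge0 ler0n. Qed.

Lemma upper_hcor_seq_nonincreasing f x e d : e <= d ->
  (limn_esup (fun m => (- m%:R^-1)%:E * lne (lower_corr f m x d)) <=
   limn_esup (fun m => (- m%:R^-1)%:E * lne (lower_corr f m x e)))%E.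
Proof.
move=> ed; apply: le_limn_esup; apply: nearW => m; rewrite !mul_oppr_inve.
by rewrite lee_wpmul2l ?inv_nat_ge0// leeN2 le_lne// le_lower_corr.
Qed.

Lemma lower_hcor_seq_nonincreasing f x e d : e <= d ->
  (limn_einf (fun m => (- m%:R^-1)%:E * lne (upper_corr f m x d)) <=
   limn_einf (fun m => (- m%:R^-1)%:E * lne (upper_corr f m x e)))%E.
Proof.
move=> ed; apply: le_limn_einf; apply: nearW => m; rewrite !mul_oppr_inve.
by rewrite lee_wpmul2l ?inv_nat_ge0// leeN2 le_lne// le_upper_corr.
Qed.

Lemma htop_seq_nonincreasing f e d : e <= d ->
  (limn_esup (fun m => (m%:R^-1)%:E * lne (max_separated f m d)) <=
   limn_esup (fun m => (m%:R^-1)%:E * lne (max_separated f m e)))%E.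
Proof.
move=> ed; apply: le_limn_esup; apply: nearW => m.
by rewrite lee_wpmul2l ?inv_nat_ge0// le_lne// le_max_separated.
Qed.

Lemma lower_hcor_le_upper f x : (lower_hcor f x <= upper_hcor f x)%E.
Proof.
apply: le_lim_at_right => [e d _|e d _|e _].
- exact: lower_hcor_seq_nonincreasing.
- exact: upper_hcor_seq_nonincreasing.
(* Lower limits are bounded by upper ones twice: here in [m], then in [n], where the minus sign
   reverses the order. *)
apply: le_trans (limn_einf_sup _) _.
apply: le_limn_esup; apply: nearW => m; rewrite !mul_oppr_inve.
by rewrite lee_wpmul2l ?inv_nat_ge0// leeN2 le_lne// limn_einf_sup.
Qed.

Lemma upper_hcor_le_htop f x : (upper_hcor f x <= htop f)%E.
Proof.
apply: le_lim_at_right => [e d _|e d _|e /ltW e0].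
- exact: upper_hcor_seq_nonincreasing.
- exact: htop_seq_nonincreasing.
apply: le_limn_esup; apply: nearW => m; rewrite mul_oppr_inve.
by rewrite lee_wpmul2l ?inv_nat_ge0// lne_lower_corr.
Qed.

End Entropies.

(** * Passage to an invariant subset *)

Section RestrictedSystem.
Context {R : realType} {X : metricType R} (A : set X) (f : X -> X).
Variable fA : forall y, A y -> A (f y).
Implicit Types y z : A.

Lemma iter_restr n y : set_val (iter n (restr fA) y) = iter n f (set_val y).
Proof. by elim: n => //= n <-. Qed.

Lemma bowen_dist_restr m y z :
  bowen_dist (restr fA) m y z = bowen_dist f m (set_val y) (set_val z).
Proof. by apply: eq_bigr => i _; rewrite -!iter_restr. Qed.

Lemma corr_sum_restr m y n e :
  corr_sum (restr fA) m y n e = corr_sum f m (set_val y) n e.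
Proof.
rewrite /corr_sum; congr (_ * _%:R); apply: eq_card => p.
by rewrite !inE bowen_dist_restr !iter_restr.
Qed.

(** Correlation sums depend only on distances along the orbit of the point, which the subset
    inherits. *)
Lemma upper_hcor_restr y : upper_hcor (restr fA) y = upper_hcor f (set_val y).
Proof.
rewrite /upper_hcor /lower_corr.
by under eq_fun do under eq_fun do under eq_fun do rewrite corr_sum_restr.
Qed.

Lemma max_separated_restr m e :
  (max_separated (restr fA) m e <= max_separated f m e)%E.
Proof.
apply: ereal_sup_le => _ /= [E sepE <-].
exists [fset set_val y | y in E]%fset; last first.
  by rewrite card_imfset//; exact: val_inj.
move=> _ _ /imfsetP[y yE ->] /imfsetP[z zE ->] yz.
by rewrite -bowen_dist_restr; apply: sepE => //; apply: contraNneq yz => ->.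
Qed.

Lemma htop_restr : (htop (restr fA) <= htop f)%E.
Proof.
apply: le_lim_at_right => [e d _|e d _|e _]; try exact: htop_seq_nonincreasing.
apply: le_limn_esup; apply: nearW => m.
by rewrite lee_wpmul2l ?inv_nat_ge0// le_lne// max_separated_restr.
Qed.

End RestrictedSystem.

Theorem proposition21 (R : realType) (X : metricType R) (f : X -> X) (x : X)
    (X_compact : compact [set: X]) (f_cont : continuous f) :
  [/\ (lower_hcor f x <= upper_hcor f x)%E,
      (upper_hcor f x <= htop (restr (@orbit_closure_stable X f x f_cont)))%E &
      (htop (restr (@orbit_closure_stable X f x f_cont)) <= htop f)%E].
Proof.
split; [exact: lower_hcor_le_upper| |exact: htop_restr].
have Ox : orbit_closure f x x by apply: subset_closure; exists 0%N.
pose y : orbit_closure f x := SigSub (mem_set Ox).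
(* The general bound is applied to the restricted system, at [x] seen as the point [y] of its orbit
   closure. *)
have <- := upper_hcor_restr (@orbit_closure_stable X f x f_cont) y.
exact: upper_hcor_le_htop.
Qed.
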